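(* Let $A=(a_{ij})\in\mathbb{B}^{n\times n}$, $\lambda\in\mathbb{B}$, and let $K,L\subseteq N=\{1,\dots,n\}$ satisfy $K\cup L=N$ and $K\cap L=\emptyset$. If the set of $(K,L)$-eigenvectors of $A$ associated with eigenvalue $\lambda$ is non-empty, then it is the max-min convex hull of the points $x^{W,0}=(x_K^{W,0}\ x_L^{W,0})$, $x^{W,i}=(x_K^{W,i}\ x_L^{W,i})$ for $i\in\tilde L$, and $x^{W,k}=(x_K^{W,k}\ x_L^{W,k})$ for $k\in K$, where $$x_L^{W,0}=\lambda\mathbf{1}_L,\qquad x_K^{W,0}=(A_{KK})^*A_{KL}x_L^{W,0}\oplus(A_{KK})^*_\lambda z_K^W,$$ $$x_L^{W,i}=\lambda\mathbf{1}_L\oplus e_i,\qquad x_K^{W,i}=(A_{KK})^*A_{KL}x_L^{W,i}\oplus(A_{KK})^*_\lambda z_K^W,$$ $$x_L^{W,k}=\lambda\mathbf{1}_L,\qquad x_K^{W,k}=(A_{KK})^*A_{KL}x_L^{W,k}\oplus(A_{KK})^*_\lambda(z_K^W\oplus e_k),$$ and $W$ ranges over all subsets $W\subseteq\tilde N$ such that $\{C_j:j\in W\}$ is a minimal covering of $I_0$.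
   Context: Max-min algebra: $\mathbb{B}=[0,1]$ with $a\oplus b=\max(a,b)$ and $a\otimes b=ab=\min(a,b)$, extended to matrices and vectors in the usual way ($(A\oplus B)_{ij}=a_{ij}\oplus b_{ij}$, $(AB)_{ij}=\bigoplus_k a_{ik}b_{kj}$, $(\lambda x)_i=\lambda x_i$); an empty sum is $0$ and conditions indexed by an empty set hold vacuously. Inequalities between vectors are componentwise. $\mathbf 1_L$ is the all-ones vector indexed by $L$; $e_i$ is the unit vector (of the appropriate index set, $L$ or $K$) with $i$th component $1$ and other components $0$. For index sets $P,Q\subseteq N$, $A_{PQ}$ is the submatrix of $A$ with rows in $P$ and columns in $Q$, and $x_P$ is the subvector of $x$ indexed by $P$. The max-min convex hull of finitely many points $y^1,\dots,y^m\in\mathbb{B}^n$ is the set of all $\alpha_1y^1\oplus\dots\oplus\alpha_my^m$ with $\alpha_1,\dots,\alpha_m\in\mathbb{B}$ and $\alpha_1\oplus\dots\oplus\alpha_m=1$. For a square matrix $M$ over $\mathbb{B}$: $M^+=M\oplus M^2\oplus M^3\oplus\cdots$ and $M^*=I\oplus M\oplus M^2\oplus\cdots$ (these series stabilize after finitely many terms), where $I$ has $1$ on the diagonal and $0$ elsewhere; $M^*_\lambda$ is the matrix whose $i$th column is $\lambda\,(M^+)_{ii}\,(M^* )_{\cdot i}$. $(A_{KK})^*_\lambda$ is this matrix for $M=A_{KK}$. A $(K,L)$-eigenvector of $A$ associated with $\lambda$ is a vector $x\in\mathbb{B}^n$ with $Ax=\lambda x$, $x_i\le\lambda$ for all $i\in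 K$ and $x_i\ge\lambda$ for all $i\in L$ (the zero vector is not excluded). Define $L_1=\{i\in L:\bigoplus_{j\in L}a_{ij}\ge\lambda\}$, $L_2=\{i\in L:\bigoplus_{j\in L}a_{ij}<\lambda\}$, $L^{>\lambda,L_1}=\{k\in L:\max_{i\in L_1}a_{ik}>\lambda\}$, $L^{>\lambda,K}=\{\ell\in L:\max_{k\in K}((A_{KK})^*A_{KL})_{k\ell}>\lambda\}$, $L'=L^{>\lambda,L_1}\cup L^{>\lambda,K}$, $\tilde L=L\setminus L'$, $\tilde N=\tilde L\cup K$. Let $A'=(A_{L_2K}(A_{KK})^*A_{K\tilde L},\ A_{L_2K}(A_{KK})^*_\lambda)$ (rows indexed by $L_2$, columns by $\tilde N=\tilde L\cup K$). Let $I_0=\{i\in L_2: A_{iK}(A_{KK})^*A_{KL}\mathbf{1}_L<\lambda\}$, and $C_j=\{i\in I_0:(A')_{ij}=\lambda\}$ for $j\in\tilde N$. For $W\subseteq\tilde N$, $\{C_j:j\in W\}$ is a covering of $I_0$ if $\bigcup_{j\in W}C_j=I_0$, and a minimal covering if moreover $\bigcup_{j\in V}C_j\ne I_0$ for every proper subset $V\subsetneq W$. For such $W$, $z^W\in\mathbb{B}^{\tilde N}$ is given by $z^W_j=\lambda$ for $j\in W$ and $z^W_j=0$ otherwise, and $z^W_K$ is its subvector indexed by $K$. *)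

(* Defs.v *)
From HB Require Import structures.
From mathcomp Require Import all_boot all_order all_algebra.
From mathcomp Require Import reals.

Set Implicit Arguments.
Unset Strict Implicit.
Unset Printing Implicit Defensive.

Import Order.TTheory GRing.Theory Num.Theory.
Local Open Scope ring_scope.

(* The max-min algebra on [0,1] is set up as a commutative semiring, so that
   in what follows +, *, \sum, *m, ^+, *: on maxmin R and on matrices over it
   are the max-min operations. The order is that of R, in ring_scope. *)
Record maxmin (R : realType) :=
  MaxMin { mmval : R; mmvalP : 0 <= mmval <= 1 }.

HB.instance Definition _ (R : realType) := [isSub for @mmval R].
HB.instance Definition _ (R : realType) := [Choice of maxmin R by <:].
HB.instance Definition _ (R : realType) :=
  [SubChoice_isSubOrder of maxmin R by <: with ring_display].

Fact maxmin0_subproof (R : realType) : 0 <= (0 : R) <= 1.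
Proof. by rewrite lexx ler01. Qed.

Fact maxmin1_subproof (R : realType) : 0 <= (1 : R) <= 1.
Proof. by rewrite lexx ler01. Qed.

Definition maxmin0 (R : realType) : maxmin R := MaxMin (maxmin0_subproof R).
Definition maxmin1 (R : realType) : maxmin R := MaxMin (maxmin1_subproof R).

Fact maxmin_ge0 (R : realType) (a : maxmin R) : maxmin0 R <= a.
Proof. by case/andP: (mmvalP a). Qed.

Fact maxmin_le1 (R : realType) (a : maxmin R) : a <= maxmin1 R.
Proof. by case/andP: (mmvalP a). Qed.

Fact max_maxmin0 (R : realType) :
  left_id (maxmin0 R) (Order.max : maxmin R -> maxmin R -> maxmin R).
Proof. by move=> a; apply/max_r/maxmin_ge0. Qed.

Fact min_maxmin1 (R : realType) :
  left_id (maxmin1 R) (Order.min : maxmin R -> maxmin R -> maxmin R).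
Proof. by move=> a; apply/min_r/maxmin_le1. Qed.

Fact min_maxmin0 (R : realType) :
  left_zero (maxmin0 R) (Order.min : maxmin R -> maxmin R -> maxmin R).
Proof. by move=> a; apply/min_l/maxmin_ge0. Qed.

Fact maxmin1_neq0 (R : realType) : maxmin1 R != maxmin0 R.
Proof. by rewrite -val_eqE /= oner_neq0. Qed.

HB.instance Definition _ (R : realType) :=
  GRing.isNmodule.Build (maxmin R) (@maxA _ _) (@maxC _ _) (@max_maxmin0 R).
HB.instance Definition _ (R : realType) :=
  GRing.Nmodule_isComNzSemiRing.Build (maxmin R) (@minA _ _) (@minC _ _)
    (@min_maxmin1 R) (@min_maxl _ _) (@min_maxmin0 R) (@maxmin1_neq0 R).

Lemma maxminD (R : realType) (a b : maxmin R) : a + b = Order.max a b.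
Proof. by []. Qed.

Lemma maxminM (R : realType) (a b : maxmin R) : a * b = Order.min a b.
Proof. by []. Qed.

(* The rows and columns of a submatrix A_PQ are indexed by 'I_#|P| and 'I_#|Q|
   through enum_val. *)
Definition submat (R : realType) (n : nat) (P Q : {set 'I_n})
    (A : 'M[maxmin R]_n) : 'M[maxmin R]_(#|P|, #|Q|) :=
  mxsub (@enum_val _ (mem P)) (@enum_val _ (mem Q)) A.

Definition subvec (R : realType) (n : nat) (P : {set 'I_n})
    (x : 'cV[maxmin R]_n) : 'cV[maxmin R]_#|P| :=
  rowsub (@enum_val _ (mem P)) x.

(* The vector x with x_K = xK, x_L = xL, when K and L partition the indices *)
Definition glue (R : realType) (n : nat) (K L : {set 'I_n})
    (xK : 'cV[maxmin R]_#|K|) (xL : 'cV[maxmin R]_#|L|) : 'cV[maxmin R]_n :=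
  \col_i (\sum_(k | enum_val k == i) xK k 0 + \sum_(l | enum_val l == i) xL l 0).

(* Since M ^+ k for k > m is dominated by the sum of M, ..., M ^+ m (see
   kplus_stable, kstar_stable), the infinite series are truncated at the
   dimension m. *)
Definition kplus (R : realType) (m : nat) (M : 'M[maxmin R]_m) : 'M_m :=
  \sum_(1 <= k < m.+1) M ^+ k.

Definition kstar (R : realType) (m : nat) (M : 'M[maxmin R]_m) : 'M_m :=
  \sum_(0 <= k < m.+1) M ^+ k.

Lemma maxmin_le_sumP (R : realType) (I : finType) (F : I -> maxmin R)
    (h : maxmin R) :
  h != 0 -> h <= \sum_i F i -> exists i, h <= F i.
Proof.
move=> h0; elim/big_ind: _ => [|a b IHa IHb|i _]; last by exists i.
- by move=> h0'; case/eqP: h0; apply/le_anti; rewrite h0' maxmin_ge0.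
- by rewrite maxminD le_max => /orP[].
Qed.

Lemma maxmin_le_sum (R : realType) (I : finType) (F : I -> maxmin R) (i : I) :
  F i <= \sum_j F j.
Proof. by rewrite (bigD1 i) //= maxminD le_max lexx. Qed.

Lemma maxmin_exp_path (R : realType) (m : nat) (M : 'M[maxmin R]_m)
    (h : maxmin R) (k : nat) (i j : 'I_m) :
  h != 0 -> h <= (M ^+ k) i j ->
  exists p, [/\ size p = k, path (fun a b => h <= M a b) i p & last i p = j].
Proof.
move=> h0; elim: k i => [|k IHk] i.
  rewrite expr0 mxE; case: eqP => [-> _|_]; first by exists [::].
  by move=> h0'; case/eqP: h0; apply/le_anti; rewrite h0' maxmin_ge0.
rewrite exprS mxE => /(maxmin_le_sumP h0)[l].
rewrite maxminM le_min => /andP[hil /IHk[p [sp pp lp]]].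
by exists (l :: p); rewrite /= sp hil.
Qed.

Lemma maxmin_path_exp (R : realType) (m : nat) (M : 'M[maxmin R]_m)
    (h : maxmin R) (p : seq 'I_m) (i : 'I_m) :
  path (fun a b => h <= M a b) i p -> h <= (M ^+ size p) i (last i p).
Proof.
elim: p i => [|l p IHp] i /=; first by rewrite mxE eqxx maxmin_le1.
case/andP=> hil /IHp hp; rewrite exprS mxE.
by apply: le_trans (maxmin_le_sum _ l); rewrite maxminM le_min hil.
Qed.

Lemma maxmin_le_sumnat (R : realType) (m a b k : nat) (M : 'M[maxmin R]_m)
    (i j : 'I_m) :
  (a <= k < b)%N -> (M ^+ k) i j <= (\sum_(a <= l < b) M ^+ l) i j.
Proof.
case/andP=> ak kb; rewrite (@big_cat_nat _ _ _ k) ?(ltnW kb) //=.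
by rewrite (big_ltn kb) !mxE !maxminD !le_max lexx !orbT.
Qed.

Lemma expr_le_kplus (R : realType) (m k : nat) (M : 'M[maxmin R]_m)
    (i j : 'I_m) :
  (0 < k)%N -> (M ^+ k) i j <= kplus M i j.
Proof.
case: k => // k _; have [->|h0] := eqVneq ((M ^+ k.+1) i j) 0.
  exact: maxmin_ge0.
have [[|l p] [//= _ /andP[hil pp] lp]] := maxmin_exp_path h0 (lexx _).
move: hil pp lp; set h := (M ^+ k.+1) i j => hil pp <-.
case/shortenP: pp => q pq uq _.
have := @maxmin_path_exp _ _ M h (l :: q) i.
rewrite /= hil pq => /(_ isT) /le_trans; apply.
apply: maxmin_le_sumnat; rewrite /= ltnS.
by have := max_card (mem (l :: q)); rewrite (card_uniqP uq) card_ord.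
Qed.

Lemma expr_le_kstar (R : realType) (m k : nat) (M : 'M[maxmin R]_m)
    (i j : 'I_m) :
  (M ^+ k) i j <= kstar M i j.
Proof.
case: k => [|k]; first exact: maxmin_le_sumnat.
rewrite (le_trans (expr_le_kplus _ _ _ _)) // /kstar big_ltn // mxE.
by rewrite maxminD le_max lexx orbT.
Qed.

Lemma maxmin_sum_absorb (R : realType) (m b c : nat) (M S : 'M[maxmin R]_m) :
  (forall k i j, (b <= k)%N -> (M ^+ k) i j <= S i j) ->
  S + \sum_(b <= k < c) M ^+ k = S.
Proof.
move=> le_S; apply/matrixP => i j; rewrite mxE maxminD; apply/max_l.
rewrite big_nat; elim/big_ind: _ => [|x y Hx Hy|k /andP[bk _]].
- by rewrite mxE maxmin_ge0.
- by rewrite mxE maxminD ge_max Hx Hy.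
- exact: le_S.
Qed.

Lemma kplus_stable (R : realType) (m p : nat) (M : 'M[maxmin R]_m) :
  (m <= p)%N -> \sum_(1 <= k < p.+1) M ^+ k = kplus M.
Proof.
move=> mp; rewrite (@big_cat_nat _ _ _ m.+1) //=.
by apply: maxmin_sum_absorb => k i j mk; apply/expr_le_kplus/leq_trans/mk.
Qed.

Lemma kstar_stable (R : realType) (m p : nat) (M : 'M[maxmin R]_m) :
  (m <= p)%N -> \sum_(0 <= k < p.+1) M ^+ k = kstar M.
Proof.
move=> mp; rewrite (@big_cat_nat _ _ _ m.+1) //=.
by apply: maxmin_sum_absorb => k i j _; apply: expr_le_kstar.
Qed.

Definition kstar_lam (R : realType) (m : nat) (lam : maxmin R)
    (M : 'M[maxmin R]_m) : 'M_m :=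
  \matrix_(i, j) (lam * kplus M j j * kstar M i j).

Definition KL_eigenvector (R : realType) (n : nat) (A : 'M[maxmin R]_n)
    (lam : maxmin R) (K L : {set 'I_n}) (x : 'cV[maxmin R]_n) : Prop :=
  [/\ A *m x = lam *: x,
      forall i, i \in K -> x i 0 <= lam
    & forall i, i \in L -> lam <= x i 0].

Definition maxmin_hull (R : realType) (n : nat) (s : seq 'cV[maxmin R]_n)
    (x : 'cV[maxmin R]_n) : Prop :=
  exists alpha : 'I_(size s) -> maxmin R,
    \sum_i alpha i = 1 /\ x = \sum_i alpha i *: s`_i.

Definition L1 (R : realType) (n : nat) (A : 'M[maxmin R]_n) (lam : maxmin R)
    (L : {set 'I_n}) : {set 'I_n} :=
  [set i in L | lam <= \sum_(j in L) A i j].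

Definition L2 (R : realType) (n : nat) (A : 'M[maxmin R]_n) (lam : maxmin R)
    (L : {set 'I_n}) : {set 'I_n} :=
  [set i in L | \sum_(j in L) A i j < lam].

Definition Lgt_L1 (R : realType) (n : nat) (A : 'M[maxmin R]_n)
    (lam : maxmin R) (L : {set 'I_n}) : {set 'I_n} :=
  [set k in L | lam < \sum_(i in L1 A lam L) A i k].

Definition Lgt_K (R : realType) (n : nat) (A : 'M[maxmin R]_n)
    (lam : maxmin R) (K L : {set 'I_n}) : {set 'I_n} :=
  [set enum_val l | l : 'I_#|L| &
     lam < \sum_k (kstar (submat K K A) *m submat K L A) k l].

Definition Ltilde (R : realType) (n : nat) (A : 'M[maxmin R]_n)
    (lam : maxmin R) (K L : {set 'I_n}) : {set 'I_n} :=
  L :\: (Lgt_L1 A lam L :|: Lgt_K A lam K L).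

(* The index set Ntilde = Ltilde U K (disjoint union) is represented by
   'I_(#|Ltilde| + #|K|). *)
Notation Ntilde A lam K L := 'I_(#|Ltilde A lam K L| + #|K|).

Definition Aprime (R : realType) (n : nat) (A : 'M[maxmin R]_n)
    (lam : maxmin R) (K L : {set 'I_n}) :
    'M[maxmin R]_(#|L2 A lam L|, #|Ltilde A lam K L| + #|K|) :=
  row_mx (submat (L2 A lam L) K A *m kstar (submat K K A)
            *m submat K (Ltilde A lam K L) A)
         (submat (L2 A lam L) K A *m kstar_lam lam (submat K K A)).

Definition I0 (R : realType) (n : nat) (A : 'M[maxmin R]_n)
    (lam : maxmin R) (K L : {set 'I_n}) : {set 'I_#|L2 A lam L|} :=
  [set i | (submat (L2 A lam L) K A *m kstar (submat K K A)
              *m submat K L A *m const_mx 1) i (0 : 'I_1) < lam].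

Definition C_ (R : realType) (n : nat) (A : 'M[maxmin R]_n)
    (lam : maxmin R) (K L : {set 'I_n}) (j : Ntilde A lam K L) :
    {set 'I_#|L2 A lam L|} :=
  [set i in I0 A lam K L | Aprime A lam K L i j == lam].

Definition covering (R : realType) (n : nat) (A : 'M[maxmin R]_n)
    (lam : maxmin R) (K L : {set 'I_n}) (W : {set Ntilde A lam K L}) : bool :=
  \bigcup_(j in W) C_ j == I0 A lam K L.

Definition minimal_covering (R : realType) (n : nat) (A : 'M[maxmin R]_n)
    (lam : maxmin R) (K L : {set 'I_n}) (W : {set Ntilde A lam K L}) : bool :=
  covering W && [forall (V : {set Ntilde A lam K L} | V \proper W), ~~ covering V].

Definition zW (R : realType) (n : nat) (A : 'M[maxmin R]_n)
    (lam : maxmin R) (K L : {set 'I_n}) (W : {set Ntilde A lam K L}) :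
    'cV[maxmin R]_(#|Ltilde A lam K L| + #|K|) :=
  \col_j (if j \in W then lam else 0).

Definition zWK (R : realType) (n : nat) (A : 'M[maxmin R]_n)
    (lam : maxmin R) (K L : {set 'I_n}) (W : {set Ntilde A lam K L}) :
    'cV[maxmin R]_#|K| := dsubmx (zW W).

(* The vector with L-part xL and
   K-part (A_KK)^* A_KL xL + (A_KK)^*_lam zK *)
Definition KL_point (R : realType) (n : nat) (A : 'M[maxmin R]_n)
    (lam : maxmin R) (K L : {set 'I_n})
    (xL : 'cV[maxmin R]_#|L|) (zK : 'cV[maxmin R]_#|K|) : 'cV[maxmin R]_n :=
  glue (kstar (submat K K A) *m submat K L A *m xL
          + kstar_lam lam (submat K K A) *m zK)
       xL.

Arguments KL_point {R n} A lam K L xL zK.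

Definition unitvec (R : realType) (n : nat) (i : 'I_n) : 'cV[maxmin R]_n :=
  delta_mx i 0.

Definition xW0 (R : realType) (n : nat) (A : 'M[maxmin R]_n)
    (lam : maxmin R) (K L : {set 'I_n}) (W : {set Ntilde A lam K L}) :
    'cV[maxmin R]_n :=
  KL_point A lam K L (lam *: const_mx 1) (zWK W).

Definition xWL (R : realType) (n : nat) (A : 'M[maxmin R]_n)
    (lam : maxmin R) (K L : {set 'I_n}) (W : {set Ntilde A lam K L})
    (i : 'I_n) : 'cV[maxmin R]_n :=
  KL_point A lam K L (lam *: const_mx 1 + subvec L (unitvec R i)) (zWK W).

Definition xWK (R : realType) (n : nat) (A : 'M[maxmin R]_n)
    (lam : maxmin R) (K L : {set 'I_n}) (W : {set Ntilde A lam K L})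
    (k : 'I_n) : 'cV[maxmin R]_n :=
  KL_point A lam K L (lam *: const_mx 1) (zWK W + subvec K (unitvec R k)).

Definition KL_generators (R : realType) (n : nat) (A : 'M[maxmin R]_n)
    (lam : maxmin R) (K L : {set 'I_n}) : seq 'cV[maxmin R]_n :=
  let mincov := enum (@minimal_covering R n A lam K L) in
  [seq xW0 W | W <- mincov]
  ++ [seq xWL W i | W <- mincov, i <- enum (Ltilde A lam K L)]
  ++ [seq xWK W k | W <- mincov, k <- enum K].

(* Main.v *)
Require Import Defs.
From HB Require Import structures.
From mathcomp Require Import all_boot all_order all_algebra.
From mathcomp Require Import reals.

Set Implicit Arguments.
Unset Strict Implicit.
Unset Printing Implicit Defensive.

Import Order.TTheory GRing.Theory Num.Theory.
Local Open Scope ring_scope.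

(** Write M for A_KK, B for A_KL, and S, S_lam for the matrices kstar M and
kstar_lam lam M.  The proof solves the eigenvector equation A x = lam x for
x_L >= lam >= x_K block by block.

On the rows in K the right-hand side is x_K itself, because x_K <= lam, so the
equation reads x_K = M x_K + B x_L.  Unrolling this fixpoint equation more
times than M has rows leaves S B x_L plus a contribution of long paths; such a
path revisits some vertex j, hence passes through a cycle at j, and is
therefore dominated by column j of S_lam weighted by x_j.  So x_K = S B x_L +
S_lam z with z = x_K (fixpoint_kstar), and conversely every vector of this form
solves the equation (kstar_fixpoint).

On the rows in L the right-hand side is the constant lam, because x_L >= lam.
The inequalities A_LL x_L <= lam and x_K <= lam hold exactly when x_l = lam for
all l outside Ltilde: such an l has an entry a_il with i in L1, or an entry
(S B)_kl, that exceeds lam, and then the minimum of this entry and x_l is at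
most lam only if x_l is.  In the rows of L2 all entries of A_LL are below lam.
The inequality A x >= lam is automatic on L1, and also on the rows of L2
outside I0, where A_LK S B x_L is already large enough.  On a row r in I0
neither A_LL x_L nor A_LK S B x_L can reach lam, so some k with z_k >= lam must
have r in C_k.  In other words the set of k with z_k >= lam gives a covering of
I0, which contains a minimal covering W, and this means z >= z^W.

Hence the eigenvectors are the points KL_point x_L z with x_L >= lam, x_L = lam
outside Ltilde, and z >= z^W for some minimal covering W
(KL_point_eigenvector, eigenvector_KL_point).  Since KL_point is linear in the
pair (x_L, z), such a point is the combination of the generators with the same
W in which x^{W,0} has coefficient 1, x^{W,i} has coefficient x_i and x^{W,k}
has coefficient z_k (KL_point_generators).  The converse holds because the
eigenvectors form a max-min convex set (KL_eigenvector_hull). *)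

(** * Order in max-min algebra *)

Section MaxMin.
Variable R : realType.
Implicit Types (a b c h lam : maxmin R) (m n p : nat).

Lemma maxmin_sum_le (I : finType) (P : pred I) (F : I -> maxmin R) c :
  (forall i, P i -> F i <= c) -> \sum_(i | P i) F i <= c.
Proof.
move=> Fc; elim/big_ind: _ => // [|a b ac bc]; first exact: maxmin_ge0.
by rewrite maxminD ge_max ac.
Qed.

Lemma maxmin_le_sum_cond (I : finType) (P : pred I) (F : I -> maxmin R) i :
  P i -> F i <= \sum_(j | P j) F j.
Proof. by move=> Pi; rewrite (bigD1 i) //= maxminD le_max lexx. Qed.

Lemma maxmin_lt_sumP (I : finType) (P : pred I) (F : I -> maxmin R) c :
  c < \sum_(i | P i) F i -> exists2 i, P i & c < F i.
Proof.
elim/big_ind: _ => [|a b IHa IHb|i Pi ci]; last by exists i.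
- by move=> c0; have:= lt_le_trans c0 (maxmin_ge0 c); rewrite ltxx.
- by rewrite maxminD lt_max => /orP[].
Qed.

Lemma maxmin_sum_mono (I : finType) (P : pred I) (F G : I -> maxmin R) :
  (forall i, P i -> F i <= G i) -> \sum_(i | P i) F i <= \sum_(i | P i) G i.
Proof.
move=> FG; apply: maxmin_sum_le => i Pi.
exact: le_trans (FG i Pi) (maxmin_le_sum_cond _ Pi).
Qed.

Lemma maxmin_mul_mono a b c d : a <= c -> b <= d -> a * b <= c * d.
Proof. by move=> ac bd; rewrite !maxminM le_min !ge_min ac bd orbT. Qed.

Lemma maxmin_mulmx_mono m n p (A : 'M[maxmin R]_(m, n))
    (X Y : 'M[maxmin R]_(n, p)) i j :
  (forall k, X k j <= Y k j) -> (A *m X) i j <= (A *m Y) i j.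
Proof.
move=> XY; rewrite !mxE; apply: maxmin_sum_mono => k _.
exact: maxmin_mul_mono.
Qed.

Lemma maxmin_mulmx_le m n p (A : 'M[maxmin R]_(m, n)) (X : 'M[maxmin R]_(n, p))
    i j c :
  (forall k, A i k * X k j <= c) -> (A *m X) i j <= c.
Proof. by move=> AXc; rewrite mxE; apply: maxmin_sum_le => k _. Qed.

Lemma maxmin_le_mulmx m n p (A : 'M[maxmin R]_(m, n)) (X : 'M[maxmin R]_(n, p))
    i k j :
  A i k * X k j <= (A *m X) i j.
Proof. by rewrite [leRHS]mxE; apply: (maxmin_le_sum_cond (fun k => _)). Qed.

Lemma maxmin_mulrr a : a * a = a.
Proof. by rewrite maxminM minxx. Qed.

Lemma maxmin_addr1 a : a + 1 = 1.
Proof. exact/max_r/maxmin_le1. Qed.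

(** * Powers and the equation x = M x + b *)

Section Powers.
Variables (m : nat) (M : 'M[maxmin R]_m).

Lemma mulmx_kstar : M *m kstar M = kplus M.
Proof.
rewrite -(@kplus_stable _ _ m.+1) // big_add1 /= /kstar mulmx_sumr.
by apply: eq_bigr => k _; rewrite exprS.
Qed.

Lemma kstarE : kstar M = 1%:M + kplus M.
Proof. by rewrite /kstar big_ltn. Qed.

(** Off the diagonal M * kstar M and kstar M agree; the factor (kplus M)_jj in
column j hides the remaining difference on the diagonal, where kstar M has
entry 1 and kplus M only (kplus M)_jj. *)
Lemma mulmx_kstar_lam lam : M *m kstar_lam lam M = kstar_lam lam M.
Proof.
apply/matrixP=> i j; rewrite [RHS]mxE.
transitivity (lam * kplus M j j * (M *m kstar M) i j).
  rewrite !mxE big_distrr; apply: eq_bigr => k _ /=.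
  by rewrite mxE mulrCA.
rewrite mulmx_kstar kstarE [(_ + kplus M) i j]mxE mxE -!mulrA; congr (_ * _).
have [->|_] := eqVneq i j; last by rewrite add0r.
by rewrite addrC maxmin_addr1 mulr1 maxmin_mulrr.
Qed.

Lemma kstar_lam_le lam i j : kstar_lam lam M i j <= lam.
Proof. by rewrite mxE !maxminM !ge_min lexx. Qed.

Lemma kstar_lam_mul_le lam (z : 'cV[maxmin R]_m) i :
  (kstar_lam lam M *m z) i 0 <= lam.
Proof.
apply: maxmin_mulmx_le => k.
by rewrite maxminM ge_min kstar_lam_le.
Qed.

Lemma kstar_fixpoint lam (b z : 'cV[maxmin R]_m) :
  let x := kstar M *m b + kstar_lam lam M *m z in M *m x + b = x.
Proof.
rewrite /= mulmxDr !mulmxA mulmx_kstar mulmx_kstar_lam addrAC.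
by rewrite kstarE mulmxDl mul1mx [in RHS](addrC b).
Qed.

Lemma fixpoint_unroll (b x : 'cV[maxmin R]_m) p :
  M *m x + b = x -> x = M ^+ p *m x + (\sum_(0 <= k < p) M ^+ k) *m b.
Proof.
move=> xE; elim: p => [|p IHp].
  by rewrite expr0 mul1mx big_geq // mul0mx addr0.
have step : M ^+ p *m x = M ^+ p.+1 *m x + M ^+ p *m b.
  by rewrite exprSr -mulmxA -mulmxDr xE.
have -> : \sum_(0 <= k < p.+1) M ^+ k = M ^+ p + \sum_(0 <= k < p) M ^+ k.
  by rewrite addrC; apply: big_nat_recr.
rewrite [LHS]IHp step -addrA.
move: (M ^+ p.+1 *m x) (M ^+ p) (\sum_(0 <= k < p) M ^+ k) => u Q S.
by rewrite mulmxDl.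
Qed.

Lemma subfixpoint_pow_le (x : 'cV[maxmin R]_m) k i :
  (forall i, (M *m x) i 0 <= x i 0) -> (M ^+ k *m x) i 0 <= x i 0.
Proof.
move=> Mx; elim: k i => [|k IHk] i; first by rewrite expr0 mul1mx.
rewrite exprSr -mulmxA.
apply: le_trans (IHk i); apply: maxmin_mulmx_mono => j; exact: Mx.
Qed.

(** The segment between positions a and b of a path with edge weights at least
h witnesses that M ^+ (b - a) is at least h between its endpoints. *)
Lemma exp_nth_le h (p : seq 'I_m) i (a b : nat) :
  path (fun i j => h <= M i j) i p ->
  (a <= b <= size p)%N ->
  h <= (M ^+ (b - a)) (nth i (i :: p) a) (nth i (i :: p) b).
Proof.
move=> pp /andP[ab bp].
have nthh k : (k < size p)%N -> h <= M (nth i (i :: p) k) (nth i (i :: p) k.+1).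
  by move=> kp; apply: (pathP i pp).
elim: b ab bp => [|b IHb] ab bp.
  by move: ab; rewrite leqn0 => /eqP->; rewrite subnn expr0 mxE eqxx maxmin_le1.
move: ab; rewrite leq_eqVlt => /orP[/eqP->|ab].
  by rewrite subnn expr0 mxE eqxx maxmin_le1.
rewrite subSn // exprSr.
apply: le_trans (maxmin_le_mulmx _ _ _ (nth i (i :: p) b) _).
by rewrite maxminM le_min IHb ?nthh // ltnW.
Qed.

(** A path with at least m edges visits some vertex j twice.  Its weight h is
at most the weights of the path from its origin i to j, of the cycle at j, and
of the path from j to its end l, so that h * x_l <= x_j is absorbed by column j
of kstar_lam. *)
Lemma pow_le_kstar_lam lam (x : 'cV[maxmin R]_m) k i : (m <= k)%N ->
  (forall i, (M *m x) i 0 <= x i 0) -> (forall i, x i 0 <= lam) ->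
  (M ^+ k *m x) i 0 <= (kstar_lam lam M *m x) i 0.
Proof.
move=> mk Mx xlam; apply: maxmin_mulmx_le => l; set h := (M ^+ k) i l.
have [->|h0] := eqVneq h 0; first by rewrite mul0r maxmin_ge0.
have [p [sp pp lp]] := maxmin_exp_path h0 (lexx h).
have : ~~ uniq (i :: p).
  apply/negP=> up; have := max_card (mem (i :: p)).
  by rewrite (card_uniqP up) card_ord /= sp leqNgt ltnS mk.
case/(uniqPn i) => a [b [ab]]; rewrite [size _]/= ltnS => bp jE.
set j := nth i (i :: p) a in jE.
have hij : h <= kstar M i j.
  apply: le_trans (expr_le_kstar a M i j).
  have := @exp_nth_le h p i 0 a pp; rewrite subn0; apply.
  exact/ltnW/(leq_trans ab).
have hjj : h <= kplus M j j.
  have := @exp_nth_le h p i a b pp; rewrite (ltnW ab) -jE -/j bp => /(_ isT).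
  by move/le_trans; apply; apply: expr_le_kplus; rewrite subn_gt0.
have hjl : h <= (M ^+ (size p - b)) j l.
  have := @exp_nth_le h p i b (size p) pp.
  by rewrite bp leqnn -jE -/j -lp (last_nth i) => /(_ isT).
have xj : h * x l 0 <= x j 0.
  apply: le_trans (subfixpoint_pow_le (size p - b) j Mx).
  by apply: le_trans (maxmin_le_mulmx _ _ _ l _); apply: maxmin_mul_mono.
apply: le_trans (maxmin_le_mulmx _ _ _ j _).
have hlam : h * x l 0 <= lam by rewrite (le_trans xj).
rewrite [kstar_lam _ _ _ _]mxE !maxminM !le_min -!maxminM hlam xj.
by rewrite !maxminM !ge_min hij hjj.
Qed.

(** Every solution x <= lam of x = M x + b serves as its own parameter in the
general solution given by kstar_fixpoint. *)
Lemma fixpoint_kstar lam (b x : 'cV[maxmin R]_m) :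
  (forall i, x i 0 <= lam) -> M *m x + b = x ->
  x = kstar M *m b + kstar_lam lam M *m x.
Proof.
move=> xlam xE.
have Mx i : (M *m x) i 0 <= x i 0.
  by rewrite -[in leRHS]xE [leRHS]mxE maxminD le_max lexx.
(* m.+1 unrollings: the sum of M ^+ k over k < m.+1 is kstar M. *)
have xU : x = M ^+ m.+1 *m x + kstar M *m b by apply: fixpoint_unroll.
apply/matrixP=> i j; rewrite ord1; apply/le_anti/andP; split.
  rewrite [in leLHS]xU mxE [leRHS]mxE !maxminD ge_max !le_max lexx /= andbT.
  by rewrite pow_le_kstar_lam ?orbT.
rewrite [leLHS]mxE maxminD ge_max; apply/andP; split.
  by rewrite [in leRHS]xU [leRHS]mxE maxminD le_max lexx orbT.
apply: maxmin_mulmx_le => k.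
(* Unrolling with b := x shows that kstar M *m x <= x. *)
have xS : M *m x + x = x.
  by apply/matrixP=> r s; rewrite mxE maxminD [s]ord1; apply/max_r.
rewrite [leRHS](_ : _ = (kstar M *m x) i 0 + (M ^+ m.+1 *m x) i 0); last first.
  by rewrite {1}(fixpoint_unroll m.+1 xS) addrC mxE.
rewrite maxminD le_max; apply/orP; left.
apply: le_trans (maxmin_le_mulmx _ _ _ k _); apply: maxmin_mul_mono => //.
by rewrite mxE !maxminM ge_min lexx orbT.
Qed.
End Powers.
End MaxMin.

(** * Splitting the indices into K and L *)

Section Partition.
Variables (R : realType) (n : nat) (K L : {set 'I_n}).
Hypotheses (hKUL : K :|: L = [set: 'I_n]) (hKIL : K :&: L = set0).
Implicit Types (A : 'M[maxmin R]_n) (x y : 'cV[maxmin R]_n).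

Lemma forall_enum_val (P : {set 'I_n}) (Q : 'I_n -> Prop) :
  (forall k : 'I_#|P|, Q (enum_val k)) -> forall i, i \in P -> Q i.
Proof. by move=> Qk i Pi; rewrite -(enum_rankK_in Pi Pi). Qed.

Lemma in_partition i : (i \in K) || (i \in L).
Proof. by rewrite -in_setU hKUL inE. Qed.

Lemma notin_partition i : i \in K -> i \in L = false.
Proof.
move=> iK; apply/negbTE/negP=> iL.
by have := in_set0 i; rewrite -hKIL inE iK iL.
Qed.

Lemma eq_subvecs x y : subvec K x = subvec K y -> subvec L x = subvec L y ->
  x = y.
Proof.
move=> xyK xyL; apply/matrixP=> i j; rewrite ord1.
case/orP: (in_partition i) => iP; move: i iP; apply: forall_enum_val => k.
  by have /matrixP/(_ k 0) := xyK; rewrite !mxE.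
by have /matrixP/(_ k 0) := xyL; rewrite !mxE.
Qed.

Lemma subvec_glueK xK xL : subvec K (@glue R n K L xK xL) = xK.
Proof.
apply/matrixP=> k j; rewrite ord1 !mxE (big_pred1 k) => [|i]; last first.
  by rewrite (inj_eq enum_val_inj).
rewrite big_pred0 ?addr0 // => l; apply/eqP=> lk.
by have := enum_valP l; rewrite /= lk (notin_partition (enum_valP k)).
Qed.

Lemma subvec_glueL xK xL : subvec L (@glue R n K L xK xL) = xL.
Proof.
apply/matrixP=> l j; rewrite ord1 !mxE addrC (big_pred1 l) => [|i]; last first.
  by rewrite (inj_eq enum_val_inj).
rewrite big_pred0 ?addr0 // => k; apply/eqP=> kl.
by have := enum_valP l; rewrite /= -kl (notin_partition (enum_valP k)).
Qed.

Lemma mulmx_partition A x i :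
  (A *m x) i 0 = \sum_(k < #|K|) A i (enum_val k) * x (enum_val k) 0
               + \sum_(l < #|L|) A i (enum_val l) * x (enum_val l) 0.
Proof.
rewrite mxE (bigID (mem K)) /= (big_enum_val (fun k => A i k * x k 0)).
congr (_ + _); rewrite -(big_enum_val (fun l => A i l * x l 0)).
apply: eq_bigl => l /=; have := in_partition l.
by have [/notin_partition->|] := boolP (l \in K).
Qed.

Lemma subvec_mulmx (P : {set 'I_n}) A x :
  subvec P (A *m x)
  = submat P K A *m subvec K x + submat P L A *m subvec L x.
Proof.
apply/matrixP=> p j; rewrite ord1 mxE mulmx_partition !mxE.
by congr (_ + _); apply: eq_bigr => k _; rewrite !mxE.
Qed.

End Partition.

(** * Max-min convex hulls *)

Section Hull.
Variables (R : realType) (n : nat).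
Implicit Types (s : seq 'cV[maxmin R]_n) (x y : 'cV[maxmin R]_n).

Lemma mem_maxmin_hull s x : x \in s -> maxmin_hull s x.
Proof.
move=> xs; have ix : (index x s < size s)%N by rewrite index_mem.
exists (fun i => if i == Ordinal ix then 1 else 0); split.
  by rewrite -big_mkcond /= big_pred1_eq.
rewrite (bigD1 (Ordinal ix)) //= eqxx scale1r nth_index // big1 ?addr0 // => i.
by move/negbTE->; rewrite scale0r.
Qed.

(** Since 1 is absorbing for max-min addition, terms with arbitrary coefficients
may be added to a point of the hull without renormalising. *)
Lemma maxmin_hull_addZ s a x y :
  maxmin_hull s x -> maxmin_hull s y -> maxmin_hull s (x + a *: y).
Proof.
case=> f [f1 ->] [g [g1 ->]]; exists (fun i => f i + a * g i); split.
  by rewrite big_split -big_distrr /= f1 g1 addrC maxmin_addr1.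
rewrite scaler_sumr -big_split; apply: eq_bigr => i _.
by rewrite scalerDl scalerA.
Qed.

Lemma maxmin_hull_sum s (I : finType) (P : pred I) (a : I -> maxmin R)
    (y : I -> 'cV[maxmin R]_n) x :
  maxmin_hull s x -> (forall i, P i -> maxmin_hull s (y i)) ->
  maxmin_hull s (x + \sum_(i | P i) a i *: y i).
Proof.
move=> sx sy; pose Q z := forall x, maxmin_hull s x -> maxmin_hull s (x + z).
suff: Q (\sum_(i | P i) a i *: y i) by apply.
elim/big_ind: _ => [w|z1 z2 Qz1 Qz2 w sw|i Pi w sw]; first by rewrite addr0.
- by rewrite addrA; apply/Qz2/Qz1.
- exact/maxmin_hull_addZ/sy.
Qed.

End Hull.

Section EigenHull.
Variables (R : realType) (n : nat) (A : 'M[maxmin R]_n) (lam : maxmin R).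
Variables K L : {set 'I_n}.

Lemma KL_eigenvector_hull s x :
  (forall y, y \in s -> KL_eigenvector A lam K L y) ->
  maxmin_hull s x -> KL_eigenvector A lam K L x.
Proof.
move=> s_eig [f [f1 ->]].
split=> [|i iK|i iL].
- rewrite mulmx_sumr scaler_sumr; apply: eq_bigr => i _.
  have [Ax _ _] := s_eig _ (mem_nth 0 (ltn_ord i)).
  by rewrite -scalemxAr Ax !scalerA mulrC.
- rewrite summxE; apply: maxmin_sum_le => j _.
  have [_ /(_ i iK) xlam _] := s_eig _ (mem_nth 0 (ltn_ord j)).
  by rewrite mxE maxminM ge_min xlam orbT.
(* The maximum of the coefficients is attained: some generator has weight 1. *)
- have [j fj] : exists j, (1 : maxmin R) <= f j.
    by apply: maxmin_le_sumP; rewrite ?f1 ?oner_neq0.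
  rewrite summxE; apply: le_trans (maxmin_le_sum _ j).
  have [_ _ /(_ i iL) xlam] := s_eig _ (mem_nth 0 (ltn_ord j)).
  by rewrite mxE maxminM le_min xlam (le_trans (maxmin_le1 _) fj).
Qed.
End EigenHull.

(** * Parametrisation of the eigenvectors *)

Section Parametrisation.
Variables (R : realType) (n : nat) (A : 'M[maxmin R]_n) (lam : maxmin R).
Variables K L : {set 'I_n}.
Hypotheses (hKUL : K :|: L = [set: 'I_n]) (hKIL : K :&: L = set0).

Local Notation Kstar := (kstar (submat K K A)).
Local Notation Kstar_lam := (kstar_lam lam (submat K K A)).
Local Notation A_KL := (submat K L A).
Local Notation A_L2K := (submat (L2 A lam L) K A).
Local Notation Lt := (Ltilde A lam K L).

Lemma subvec_KL_pointK xL z :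
  subvec K (KL_point A lam K L xL z) = Kstar *m A_KL *m xL + Kstar_lam *m z.
Proof. exact: subvec_glueK. Qed.

Lemma subvec_KL_pointL xL z : subvec L (KL_point A lam K L xL z) = xL.
Proof. exact: subvec_glueL. Qed.

Lemma Ltilde_colK_le k l : enum_val l \in Lt -> (Kstar *m A_KL) k l <= lam.
Proof.
rewrite !inE negb_or => /andP[/andP[_ lNK] _]; rewrite leNgt.
apply: contra lNK => lk; apply/imsetP; exists l => //; rewrite inE.
exact: lt_le_trans lk (maxmin_le_sum _ k).
Qed.

Lemma Ltilde_colL_le i l : i \in L -> l \in Lt -> A i l <= lam.
Proof.
move=> iL; rewrite !inE negb_or => /andP[/andP[lN1 _] lL]; rewrite leNgt.
apply: contra lN1 => il; rewrite lL /=.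
apply: lt_le_trans (il) (maxmin_le_sum_cond (fun i => A i l) _).
rewrite inE iL /= leNgt; apply/negP=> iS; have := il; rewrite ltNge.
by rewrite (le_trans (maxmin_le_sum_cond _ lL) (ltW iS)).
Qed.

Lemma I0_bound (xL : 'cV[maxmin R]_#|L|) (r : 'I_#|L2 A lam L|) :
  r \in I0 A lam K L -> (A_L2K *m Kstar *m A_KL *m xL) r 0 < lam.
Proof.
rewrite inE; apply: le_lt_trans.
by apply: maxmin_mulmx_mono => l; rewrite [leRHS]mxE maxmin_le1.
Qed.

(** An entry of A' in a column of Ltilde is one of the entries whose sum is less
than lam on I0, so minimal coverings use columns in K only. *)
Lemma C_lshift l : C_ (lshift #|K| l : Ntilde A lam K L) = set0.
Proof.
apply/setP=> r; rewrite [RHS]inE inE; apply/negbTE/negP=> /andP[rI0].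
rewrite /Aprime row_mxEl => /eqP rl.
have := enum_valP l; rewrite inE => /andP[_ lL].
pose l' := enum_rank_in lL (enum_val l).
have := I0_bound (const_mx 1) rI0; rewrite ltNge => /negP; apply.
apply: le_trans (maxmin_le_mulmx _ _ _ l' _).
rewrite [const_mx _ _ _]mxE mulr1.
suff <- : (A_L2K *m Kstar *m submat K Lt A) r l
          = (A_L2K *m Kstar *m A_KL) r l' by rewrite rl.
rewrite [LHS]mxE [RHS]mxE; apply: eq_bigr => k _; congr (_ * _).
by rewrite !mxE enum_rankK_in.
Qed.

(** The covering condition on W and z >= z^W provide, for each row r in I0, an
index k in K with (A')_rk = lam and z_k >= lam, hence the lower bound lam of
A x on that row. *)
Lemma KL_point_eigenvector (W : {set Ntilde A lam K L})
    (xL : 'cV[maxmin R]_#|L|) (z : 'cV[maxmin R]_#|K|) :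
  covering W -> (forall k, zWK W k 0 <= z k 0) -> (forall l, lam <= xL l 0) ->
  (forall l, enum_val l \notin Lt -> xL l 0 <= lam) ->
  KL_eigenvector A lam K L (KL_point A lam K L xL z).
Proof.
move=> /eqP covW Wz lamx xlam.
move: (subvec_KL_pointK xL z) (subvec_KL_pointL xL z).
move: (KL_point _ _ _ _ _ _) => x xK xL'.
have xLE l : x (enum_val l) 0 = xL l 0 by rewrite -xL' mxE.
have xKE k : x (enum_val k) 0 = subvec K x k 0 by rewrite mxE.
have xK_le (k : 'I_#|K|) : x (enum_val k) 0 <= lam.
  rewrite xKE xK mxE maxminD ge_max kstar_lam_mul_le andbT.
  apply: maxmin_mulmx_le => l; rewrite maxminM ge_min.
  have [lt|/xlam->] := boolP (enum_val l \in Lt); last by rewrite orbT.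
  by rewrite Ltilde_colK_le.
have xK_fix : submat K K A *m subvec K x + A_KL *m xL = subvec K x.
  by rewrite xK -mulmxA; apply: kstar_fixpoint.
have lam_x i : i \in L -> lam <= x i 0.
  by move: i; apply: forall_enum_val => l; rewrite xLE.
split=> //; last by apply: forall_enum_val.
apply: (eq_subvecs hKUL).
  rewrite (subvec_mulmx hKUL hKIL) xL' xK_fix.
  apply/matrixP=> k j; rewrite ord1 !mxE maxminM.
  exact/esym/min_r/xK_le.
apply/matrixP=> l j; rewrite ord1 mxE [RHS]mxE [RHS]mxE maxminM min_l ?xLE //.
move: (enum_val l) (enum_valP l) => {l j} i iL.
apply/le_anti/andP; split.
  rewrite (mulmx_partition hKUL hKIL) maxminD ge_max; apply/andP; split.
    apply: maxmin_sum_le => k _.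
    by rewrite maxminM ge_min xK_le orbT.
  apply: maxmin_sum_le => l _; rewrite maxminM ge_min xLE.
  have [lt|/xlam->] := boolP (enum_val l \in Lt); last by rewrite orbT.
  by rewrite Ltilde_colL_le.
have [iL1|iNL1] := boolP (lam <= \sum_(j in L) A i j).
  rewrite (mulmx_partition hKUL hKIL) maxminD le_max; apply/orP; right.
  rewrite -{1}[lam]maxmin_mulrr.
  apply: le_trans (maxmin_mul_mono iL1 (lexx lam)) _.
  rewrite big_enum_val big_distrl /=; apply: maxmin_sum_mono => l _.
  by rewrite maxmin_mul_mono ?xLE.
(* On the rows of L2 the bound has to come from x_K alone. *)
have : i \in L2 A lam L by rewrite inE iL ltNge.
move: i {iL iNL1}; apply: forall_enum_val => r.
have -> : (A *m x) (enum_val r) 0 = subvec (L2 A lam L) (A *m x) r 0.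
  by rewrite [RHS]mxE.
rewrite (subvec_mulmx hKUL hKIL) mxE maxminD le_max; apply/orP; left.
rewrite xK mulmxDr !mulmxA mxE maxminD le_max.
have [rI0|] := boolP (r \in I0 A lam K L); last first.
  rewrite inE -leNgt => rN; apply/orP; left.
  have lam2 : lam <= lam * lam by rewrite maxmin_mulrr.
  apply: le_trans lam2 _; apply: le_trans (maxmin_mul_mono (lexx lam) rN) _.
  rewrite [in leLHS]mxE big_distrr [leRHS]mxE; apply: maxmin_sum_mono => l _ /=.
  by rewrite [const_mx _ _ _]mxE mulr1 mulrC maxmin_mul_mono.
apply/orP; right; move: (rI0); rewrite -covW => /bigcupP[j jW].
case: (splitP j) => l jl.
  have -> : j = lshift _ l by apply/val_inj.
  by rewrite C_lshift inE.
have -> : j = rshift _ l by apply/val_inj.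
rewrite inE => /andP[_]; rewrite /Aprime row_mxEr => /eqP rl.
apply: le_trans (maxmin_le_mulmx _ _ _ l _).
rewrite rl maxminM le_min lexx /=; apply: le_trans (Wz l).
have jE : j = rshift _ l by apply/val_inj.
by rewrite /zWK !mxE -jE jW.
Qed.


Lemma covering_minimal (V : {set Ntilde A lam K L}) :
  covering V -> exists2 W : {set Ntilde A lam K L},
    minimal_covering W & W \subset V.
Proof.
case/(@minset_exists _ (@covering R n A lam K L)) => W /minsetP[covW minW] WV.
exists W => //; apply/andP; split=> //; apply/forall_inP=> U UW.
apply/negP=> covU; have := properxx W.
by rewrite -{1}(minW U covU (proper_sub UW)) UW.
Qed.

(** The parameter z is x_K itself, and W is extracted from the covering given by
the indices k in K at which x_k reaches lam. *)
Lemma eigenvector_KL_point (x : 'cV[maxmin R]_n) :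
  KL_eigenvector A lam K L x ->
  [/\ x = KL_point A lam K L (subvec L x) (subvec K x),
      forall l : 'I_#|L|, lam <= subvec L x l 0,
      forall l : 'I_#|L|, enum_val l \notin Lt -> subvec L x l 0 <= lam
    & exists2 W : {set Ntilde A lam K L},
        minimal_covering W & forall k, zWK W k 0 <= subvec K x k 0].
Proof.
case=> Ax xK_le lam_xL.
have xK_sub k : subvec K x k 0 <= lam by rewrite mxE xK_le ?enum_valP.
have xL_sub l : lam <= subvec L x l 0 by rewrite mxE lam_xL ?enum_valP.
have AxE i : (A *m x) i 0 = lam * x i 0 by rewrite Ax mxE.
have Ax_le i : (A *m x) i 0 <= lam by rewrite AxE maxminM ge_min lexx.
have xK_fix : submat K K A *m subvec K x + A_KL *m subvec L x = subvec K x.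
  rewrite -(subvec_mulmx hKUL hKIL); apply/matrixP=> k j.
  by rewrite ord1 mxE AxE [RHS]mxE; apply/min_r/xK_le/enum_valP.
have xKE := fixpoint_kstar xK_sub xK_fix; rewrite mulmxA in xKE.
split=> //.
- apply: (eq_subvecs hKUL); last by rewrite subvec_KL_pointL.
  by rewrite subvec_KL_pointK.
- move=> l; have lL := enum_valP l; rewrite !inE lL andbT negbK.
  case/orP=> [/maxmin_lt_sumP[i _ lam_il]|/imsetP[l' + /enum_val_inj ->]].
    have := le_trans (maxmin_le_mulmx A x i (enum_val l) 0) (Ax_le i).
    by rewrite maxminM ge_min leNgt lam_il mxE.
  rewrite inE => /maxmin_lt_sumP[k _ lam_kl].
  have : (Kstar *m A_KL) k l' * subvec L x l' 0 <= lam.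
    apply: le_trans (maxmin_le_mulmx _ _ _ _ _) _.
    apply: le_trans (xK_sub k); rewrite [in leRHS]xKE [leRHS]mxE maxminD.
    by rewrite le_max lexx.
  by rewrite maxminM ge_min leNgt lam_kl.
pose V := [set rshift #|Lt| k | k : 'I_#|K| & lam <= subvec K x k 0].
have covV : @covering R n A lam K L V.
  apply/eqP/setP=> r; apply/bigcupP/idP=> [[j _]|rI0].
    by rewrite inE => /andP[].
  have := enum_valP r; rewrite inE => /andP[rL r2].
  have lam0 : lam != 0.
    by apply/negbT/gt_eqF; apply: le_lt_trans r2; apply: maxmin_ge0.
  have AxL : (submat (L2 A lam L) L A *m subvec L x) r 0 < lam.
    apply: le_lt_trans r2; rewrite big_enum_val mxE.
    by apply: maxmin_sum_mono => l _; rewrite mxE maxminM ge_min lexx.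
  have : lam <= subvec (L2 A lam L) (A *m x) r 0.
    by rewrite mxE AxE maxminM le_min lexx lam_xL.
  rewrite (subvec_mulmx hKUL hKIL) mxE maxminD le_max [X in _ || X]leNgt AxL.
  rewrite orbF xKE mulmxDr !mulmxA mxE maxminD le_max leNgt I0_bound //=.
  rewrite mxE => /(maxmin_le_sumP lam0)[k]; rewrite maxminM le_min.
  case/andP=> lam_rk lam_k; exists (rshift _ k).
    by apply/imsetP; exists k; rewrite ?inE.
  rewrite inE rI0 /Aprime row_mxEr; apply/eqP/le_anti; rewrite lam_rk andbT.
  apply: maxmin_mulmx_le => k'.
  by rewrite maxminM ge_min kstar_lam_le orbT.
have [W minW WV] := covering_minimal covV; exists W => // k.
rewrite !mxE; case: ifP => [/(subsetP WV)|_]; last exact: maxmin_ge0.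
by case/imsetP=> k' + /rshift_inj ->; rewrite inE mxE.
Qed.

End Parametrisation.

(** * Decomposition into generators *)

Section Generators.
Variables (R : realType) (n : nat) (A : 'M[maxmin R]_n) (lam : maxmin R).
Variables K L : {set 'I_n}.

Lemma glueD (xK yK : 'cV[maxmin R]_#|K|) (xL yL : 'cV[maxmin R]_#|L|) :
  glue (xK + yK) (xL + yL) = glue xK xL + glue yK yL.
Proof.
apply/matrixP=> i j; rewrite !mxE addrACA -!big_split /=.
by congr (_ + _); apply: eq_bigr => k _; rewrite mxE.
Qed.

Lemma glueZ a (xK : 'cV[maxmin R]_#|K|) (xL : 'cV[maxmin R]_#|L|) :
  glue (a *: xK) (a *: xL) = a *: glue xK xL.
Proof.
apply/matrixP=> i j; rewrite !mxE mulrDr !big_distrr /=.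
by congr (_ + _); apply: eq_bigr => k _; rewrite mxE.
Qed.

Local Notation point := (KL_point A lam K L).

Lemma KL_pointD xL yL zK wK :
  point (xL + yL) (zK + wK) = point xL zK + point yL wK.
Proof. by rewrite /KL_point !mulmxDr addrACA glueD. Qed.

Lemma KL_pointZ a xL zK : point (a *: xL) (a *: zK) = a *: point xL zK.
Proof.
rewrite /KL_point; move: (kstar_lam _ _) (kstar _ *m _) => X Y.
rewrite -!scalemxAr -scalerDr; exact: glueZ.
Qed.

Lemma KL_point_sum (I : finType) (P : pred I) a xL zK :
  point (\sum_(i | P i) a i *: xL i) (\sum_(i | P i) a i *: zK i)
  = \sum_(i | P i) a i *: point (xL i) (zK i).
Proof.
elim/big_rec3: _ => [|i v u w _ <-]; last by rewrite KL_pointD KL_pointZ.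
by rewrite -[RHS](scale0r (point 0 0)) -KL_pointZ !scale0r.
Qed.

Hypotheses (hKUL : K :|: L = [set: 'I_n]) (hKIL : K :&: L = set0).

(** Both sides are KL_point of a pair by linearity, so it suffices to compare
the pairs.  Outside Ltilde the term lam * 1_L of x^{W,0} already gives x_l, and
the bounds lam <= x_L and z^W <= z make all the surplus terms harmless. *)
Lemma KL_point_generators (W : {set Ntilde A lam K L})
    (xL : 'cV[maxmin R]_#|L|) (z : 'cV[maxmin R]_#|K|) :
  (forall k, zWK W k 0 <= z k 0) -> (forall l, lam <= xL l 0) ->
  (forall l, enum_val l \notin Ltilde A lam K L -> xL l 0 <= lam) ->
  KL_point A lam K L xL z
  = xW0 W
    + \sum_(l : 'I_#|L| | enum_val l \in Ltilde A lam K L)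
        xL l 0 *: xWL W (enum_val l)
    + \sum_(k < #|K|) z k 0 *: xWK W (enum_val k).
Proof.
move=> Wz lam_xL xL_lam.
pose uL (l : 'I_#|L|) : 'cV[maxmin R]_#|L| :=
  lam *: const_mx 1 + subvec L (unitvec R (enum_val l)).
pose uK (k : 'I_#|K|) := zWK W + subvec K (unitvec R (enum_val k)).
rewrite -[X in _ = _ + X + _](KL_point_sum _ _ uL (fun=> zWK W)).
rewrite -[X in _ = _ + X](KL_point_sum _ _ (fun=> lam *: const_mx 1) uK).
rewrite /xW0 -!KL_pointD; congr KL_point.
- apply/matrixP=> l j; rewrite ord1; apply/le_anti/andP; split; last first.
    rewrite !mxE mulr1 !maxminD !ge_max lam_xL /= !summxE.
    apply/andP; split; apply: maxmin_sum_le => l' _.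
    + rewrite !mxE mulr1 maxminM maxminD (inj_eq enum_val_inj) andbT.
      case: eqP => [<-|_]; first by rewrite ge_min lexx.
      by rewrite (max_l (maxmin_ge0 _)) ge_min lam_xL orbT.
    + by rewrite !mxE mulr1 maxminM ge_min lam_xL orbT.
  have [lLt|/xL_lam lN] := boolP (enum_val l \in Ltilde A lam K L).
    rewrite !mxE !maxminD !le_max summxE; apply/orP; left; apply/orP; right.
    have xl : xL l 0 <= (xL l 0 *: uL l) l 0.
      by rewrite !mxE !eqxx mulr1n maxmin_addr1 mulr1.
    apply: (le_trans xl); exact: (maxmin_le_sum_cond
      (P := fun l => enum_val l \in _) (fun l' => (xL l' 0 *: uL l') l 0) lLt).
  by apply: le_trans lN _; rewrite !mxE !maxminD !le_max mulr1 lexx.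
- apply/matrixP=> k j; rewrite ord1; apply/le_anti/andP; split; last first.
    rewrite mxE maxminD ge_max mxE maxminD ge_max Wz /= !summxE.
    apply/andP; split; apply: maxmin_sum_le => k' _.
      by rewrite mxE maxminM ge_min Wz orbT.
    rewrite mxE [uK _ _ _]mxE [subvec _ _ _ _]mxE [unitvec _ _ _ _]mxE.
    rewrite (inj_eq enum_val_inj) andbT.
    case: eqP => [<-|_]; first by rewrite maxminM ge_min lexx.
    by rewrite addr0 maxminM ge_min Wz orbT.
  rewrite [leRHS]mxE maxminD le_max summxE; apply/orP; right.
  apply: le_trans (maxmin_le_sum _ k).
  by rewrite !mxE !eqxx mulr1n maxmin_addr1 mulr1.
Qed.

End Generators.

Theorem corollary3p5 (R : realType) (n : nat) (A : 'M[maxmin R]_n)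
    (lam : maxmin R) (K L : {set 'I_n})
    (hKUL : K :|: L = [set: 'I_n]) (hKIL : K :&: L = set0)
    (hne : exists x : 'cV[maxmin R]_n, KL_eigenvector A lam K L x) :
  forall x : 'cV[maxmin R]_n,
    KL_eigenvector A lam K L x <-> maxmin_hull (KL_generators A lam K L) x.
Proof.
move=> x; split=> [|]; last first.
  apply: KL_eigenvector_hull => y; rewrite !mem_cat => /or3P[].
  - case/mapP=> W; rewrite mem_enum => /andP[covW _] ->.
    by apply: (KL_point_eigenvector hKUL hKIL covW) => // l *;
      rewrite !mxE mulr1.
  - case/allpairsP=> [[W i]] /= [].
    rewrite !mem_enum => /andP[covW _] iLt ->.
    apply: (KL_point_eigenvector hKUL hKIL covW) => // l.
      by rewrite !mxE mulr1 maxminD le_max lexx.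
    move=> lNLt; rewrite !mxE mulr1; case: eqP => [li|_]; last by rewrite addr0.
    by rewrite li iLt in lNLt.
  - case/allpairsP=> [[W k]] /= [].
    rewrite !mem_enum => /andP[covW _] kK ->.
    apply: (KL_point_eigenvector hKUL hKIL covW) => [j|l|l _].
    + by rewrite [leRHS]mxE maxminD le_max lexx.
    + by rewrite !mxE mulr1.
    + by rewrite !mxE mulr1.
case/(eigenvector_KL_point hKUL hKIL) => xE lam_xL xL_lam [W minW Wz].
have W_enum : W \in enum (@minimal_covering R n A lam K L) by rewrite mem_enum.
rewrite xE (KL_point_generators Wz lam_xL xL_lam).
apply: maxmin_hull_sum; first apply: maxmin_hull_sum.
- by apply: mem_maxmin_hull; rewrite mem_cat map_f.
- move=> l lLt; apply: mem_maxmin_hull; rewrite !mem_cat.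
  apply/or3P/Or32/allpairsP; exists (W, enum_val l).
  by split; [exact: W_enum | rewrite mem_enum | reflexivity].
- move=> k _; apply: mem_maxmin_hull; rewrite !mem_cat.
  apply/or3P/Or33/allpairsP; exists (W, enum_val k).
  by split; [exact: W_enum | rewrite mem_enum enum_valP | reflexivity].
Qed.
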